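(* For every real number $s>2$ there is a constant $C=C(s)$ such that the following holds for every sufficiently large $d$. Let $G$ be an $n$-vertex graph with average degree at least $d$, where $d\leq n^{\frac{s-2}{s}}$. Then there is a non-empty set $R\subset V(G)$ of size at most $n\,d^{-\frac{s}{s-2}}(\log d)^C$ such that the induced subgraph $G[R]$ has average degree at least $s$. *)

(* Defs.v *)
From HB Require Import structures.
From mathcomp Require Import all_boot all_order all_algebra.
From mathcomp Require Import reals exp.

Set Implicit Arguments.
Unset Strict Implicit.
Unset Printing Implicit Defensive.

Import Order.TTheory GRing.Theory Num.Theory.

Local Open Scope ring_scope.

Record sgraph := SGraph {
  vertex :> finType;
  adj : rel vertex;
  adj_sym : symmetric adj;
  adj_irr : irreflexive adj }.

Definition degree (G : sgraph) (x : G) : nat := #|[set y : G | adj x y]|.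

(* The graph without vertices gets average degree 0, since 0^-1 = 0. *)
Definition avg_degree (R : realType) (G : sgraph) : R :=
  (\sum_(x : G) (degree x)%:R) / #|G|%:R.

Section Induced.
Variables (G : sgraph) (A : {set G}).

Definition induced_adj : rel {x : G | x \in A} :=
  fun x y => adj (val x) (val y).

Lemma induced_adj_sym : symmetric induced_adj.
Proof. by move=> x y; rewrite /induced_adj adj_sym. Qed.

Lemma induced_adj_irr : irreflexive induced_adj.
Proof. by move=> x; rewrite /induced_adj adj_irr. Qed.

Definition induced_subgraph : sgraph := SGraph induced_adj_sym induced_adj_irr.

End Induced.

(* Main.v *)
(* Fix integers m ~ ln d and a with a/m slightly above s/2 - 1, put c = m + a, and
   weigh a set S by pot S = m * (sum of the degrees in G[S]) - 2 * c * |S|. Passing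
   from s to 2 * c / m > s costs only a constant factor in d^(-s/(s-2)), and then it
   suffices to find a small nonempty set with pot S >= - 2 * |S|; call such sets dense.
   Suppose there is no small dense set. Call S closed if adding a bounded number of
   vertices always lowers the potential. Starting from the empty set, maintain a
   closed set S and a large set X of vertices x outside S, each with a set P x
   containing S and x whose potential is at least pot S - 2 * W. While W < m,
   replace X by its neighbourhood: this changes W to W + a, and |X| grows by a factor
   about d, because by supermodularity a vertex with c neighbours in X could be added
   to S together with the corresponding sets P x. When W >= m, choose greedily a set U
   of u vertices hitting as many neighbourhoods of X as a random set would, and
   replace S by a closed set containing S and U: this changes W to W - m. After m - 1
   expansions W is a multiple of m, so W reaches 0 while X is still nonempty, which
   contradicts the closedness of S. *)
Require Import Defs.
From HB Require Import structures.
From mathcomp Require Import all_boot all_order all_algebra.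
From mathcomp Require Import reals sequences exp.
From mathcomp Require Import zify ring lra.

Set Implicit Arguments.
Unset Strict Implicit.
Unset Printing Implicit Defensive.

Import Order.TTheory GRing.Theory Num.Theory.

Local Open Scope ring_scope.

(** * Degree sums and potentials *)

Section Darts.
Variable G : sgraph.
Implicit Types (A B P S : {set G}) (x y v : G).

Definition nbh x : {set G} := [set y | adj x y].

(** Edges are counted as ordered pairs, so that [darts A] is twice the number of edges inside [A],
    which is the degree sum of the induced subgraph. *)
Definition dart_set A : {set G * G} :=
  [set p | [&& p.1 \in A, p.2 \in A & adj p.1 p.2]].

Definition darts A : nat := #|dart_set A|.

Lemma dartsE A : darts A = (\sum_(x in A) #|nbh x :&: A|)%N.
Proof.
rewrite /darts -sum1_card.
under [RHS]eq_bigr => x _ do rewrite -sum1_card.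
rewrite pair_big_dep /=; apply: eq_bigl => -[x y].
by rewrite !inE /= [_ && (y \in A)]andbC.
Qed.

(** Each edge from [v] into [P] is counted once at [v] and once at its other end. *)
Lemma darts_setU1 v P : v \notin P ->
  darts (v |: P) = (darts P + 2 * #|nbh v :&: P|)%N.
Proof.
move=> vP; rewrite !dartsE big_setU1 //= mul2n -addnn addnCA.
congr (_ + _)%N.
  congr #|pred_of_set _|; apply/setP => y; rewrite !inE.
  by case: eqP => // ->; rewrite adj_irr.
have -> : #|nbh v :&: P| = (\sum_(x in P) (v \in nbh x))%N.
  rewrite -sum1_card big_mkcond [RHS]big_mkcond /=; apply: eq_bigr => x _.
  by rewrite !inE adj_sym andbC; case: (x \in P); case: adj.
rewrite -big_split /=; apply: eq_bigr => x xP.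
have [vx|vx] := boolP (v \in nbh x).
  have -> : nbh x :&: (v |: P) = v |: (nbh x :&: P).
    by apply/setP => y; rewrite !inE; case: eqP => // ->; rewrite inE in vx; rewrite vx.
  by rewrite cardsU1 !inE (negPf vP) andbF addn1 add1n.
rewrite addn0; congr #|pred_of_set _|; apply/setP => y; rewrite !inE.
by case: eqP => // ->; rewrite inE in vx; rewrite (negPf vx).
Qed.

Lemma darts_subset A B : A \subset B -> (darts A <= darts B)%N.
Proof.
move=> /subsetP AB; apply/subset_leq_card/subsetP => -[x y].
by rewrite !inE /= => /and3P[/AB-> /AB-> ->].
Qed.

Lemma dart_setI A B : dart_set A :&: dart_set B = dart_set (A :&: B).
Proof.
apply/setP => -[x y]; rewrite !inE /=.
by case: (x \in A); case: (x \in B); case: (y \in A); case: (y \in B); case: adj.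
Qed.

Lemma dart_setU A B : dart_set A :|: dart_set B \subset dart_set (A :|: B).
Proof.
apply/subsetP => -[x y]; rewrite !inE /=.
by case: (x \in A); case: (x \in B); case: (y \in A); case: (y \in B); case: adj.
Qed.

Lemma darts_supermodular A B :
  (darts A + darts B <= darts (A :|: B) + darts (A :&: B))%N.
Proof. by rewrite /darts -cardsUI dart_setI leq_add2r subset_leq_card // dart_setU. Qed.

(** Both orientations of the edge lie in the dart set of the union, but in neither of the two dart
    sets. *)
Lemma darts_supermodular_edge A B x y :
  x \in A -> x \notin B -> y \in B -> y \notin A -> adj x y ->
  (darts A + darts B + 2 <= darts (A :|: B) + darts (A :&: B))%N.
Proof.
move=> xA xB yB yA xy; rewrite /darts -cardsUI dart_setI addnAC leq_add2r.
have xNy : (x, y) != (y, x).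
  by apply: contra xB => /eqP[-> _].
have <- : #|[set (x, y); (y, x)]| = 2%N by rewrite cards2 xNy.
have /eqP disj : (dart_set A :|: dart_set B) :&: [set (x, y); (y, x)] == set0.
  apply/eqP/setP => -[p q]; rewrite !inE /= !xpair_eqE.
  apply/negbTE/negP => /andP[h /orP[]/andP[/eqP pE /eqP qE]]; move: h; rewrite pE qE.
    by rewrite (negPf xB) (negPf yA) /= andbF.
  by rewrite (negPf xB) (negPf yA) /= andbF.
rewrite -cardsUI disj cards0 addn0; apply/subset_leq_card.
rewrite subUset dart_setU; apply/subsetP => -[p q]; rewrite !inE !xpair_eqE /=.
by case/orP => /andP[/eqP-> /eqP->]; rewrite xA yB ?orbT //= adj_sym.
Qed.

End Darts.

(** * The potential: supermodularity and closed sets *)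

Section Potential.
Variables (G : sgraph) (m c Q : nat).
Implicit Types (A B P S U : {set G}) (x y v : G).

Definition pot A : int := (m * darts A)%:Z - (2 * c * #|A|)%:Z.

Lemma pot0 : pot set0 = 0.
Proof.
rewrite /pot cards0 muln0 subr0 (_ : darts _ = 0%N) ?muln0 //.
by rewrite dartsE big_set0.
Qed.

Lemma pot_supermodular A B : pot A + pot B <= pot (A :|: B) + pot (A :&: B).
Proof.
have := darts_supermodular A B; have := cardsUI A B.
rewrite /pot => /(congr1 (muln (2 * c))) h1 /(leq_mul (leqnn m)) h2.
by move: h1 h2; rewrite !mulnDr; lia.
Qed.

Lemma pot_supermodular_edge A B x y :
  x \in A -> x \notin B -> y \in B -> y \notin A -> adj x y ->
  pot A + pot B + (2 * m)%:Z <= pot (A :|: B) + pot (A :&: B).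
Proof.
move=> h1 h2 h3 h4 /(darts_supermodular_edge h1 h2 h3 h4).
have := cardsUI A B.
rewrite /pot => /(congr1 (muln (2 * c))) {}h1 /(leq_mul (leqnn m)) {}h2.
by move: h1 h2; rewrite !mulnDr; lia.
Qed.

Lemma pot_setU1 v P : v \notin P ->
  pot P + (2 * m * #|nbh v :&: P|)%:Z - (2 * c)%:Z <= pot (v |: P).
Proof.
by move=> vP; rewrite /pot darts_setU1 // cardsU1 vP !mulnDr; lia.
Qed.

Lemma pot_setU S U : pot S - (2 * c * #|U|)%:Z <= pot (S :|: U).
Proof.
have /(leq_mul (leqnn m)) h1 := darts_subset (subsetUl S U).
have /(leq_mul (leqnn (2 * c)%N)) h2 : (#|S :|: U| <= #|S| + #|U|)%N by rewrite cardsU leq_subr.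
rewrite /pot; move: h1 h2; rewrite mulnDr; lia.
Qed.

(** Strictness matters: a proper extension by at most [Q] vertices with deficit zero is already a
    contradiction. *)
Definition pot_closed S := forall P, S \subset P -> P != S ->
  (#|P :\: S| <= Q)%N -> pot P < pot S.

Lemma pot_closed_le S P : pot_closed S -> S \subset P ->
  (#|P :\: S| <= Q)%N -> pot P <= pot S.
Proof.
by move=> Sc SP hQ; have [->//|PS] := eqVneq P S; apply/ltW/Sc.
Qed.

(** With [c] neighbours in [S], adding [x] would gain [2 * m * c] and cost only [2 * c]. *)
Lemma pot_closed_nbh S x : (0 < m)%N -> (0 < Q)%N -> pot_closed S -> x \notin S ->
  (#|nbh x :&: S| < c)%N.
Proof.
move=> m0 Q0 Sc xS.
have hlt : pot (x |: S) < pot S.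
  apply: Sc; first exact: subsetUr.
    by apply: contra xS => /eqP <-; rewrite setU11.
  by rewrite setDUl setDv setU0 (leq_trans (subset_leq_card (subsetDl _ _))) // cards1.
have := pot_setU1 xS.
have : (#|nbh x :&: S| <= m * #|nbh x :&: S|)%N by rewrite leq_pmull.
rewrite -mulnA; lia.
Qed.

(** Deficits over a closed set are subadditive under unions. One set [P y] is added at a time by
    supermodularity. *)
Lemma pot_closed_bigcup S (P : G -> {set G}) (Y : {set G}) M W :
  pot_closed S -> (#|Y| * M <= Q)%N ->
  {in Y, forall x, S \subset P x /\ (#|P x :\: S| <= M)%N} ->
  {in Y, forall x, pot S <= pot (P x) + W%:Z} ->
  pot S <= pot (S :|: \bigcup_(x in Y) P x) + (#|Y| * W)%:Z.
Proof.
move=> Sc; have [n] := ubnP #|Y|; elim: n Y => // n IHn Y0.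
have [->|[y yY0]] := set_0Vmem Y0.
  by rewrite big_set0 setU0 cards0 mul0n addr0.
pose Y := Y0 :\ y; have {yY0} -> : Y0 = y |: Y by rewrite setD1K.
have yY : y \notin Y by rewrite setD11.
rewrite cardsU1 yY add1n !mulSn ltnS => /IHn IH hQ hP hW {IHn}.
have hQY : (#|Y| * M <= Q)%N by lia.
have [hSP hM] := hP y (setU11 _ _).
have {}IH := IH hQY (fun x xY => hP x (setU1r _ xY)) (fun x xY => hW x (setU1r _ xY)).
rewrite big_setU1 //=; set B := \bigcup_(x in Y) P x in IH *.
have := pot_supermodular (P y) (S :|: B).
have -> : P y :|: (S :|: B) = S :|: (P y :|: B) by rewrite setUCA.
(* The intersection contains [S] and has at most [M] further vertices, so closedness applies to
   it. *)
have : pot (P y :&: (S :|: B)) <= pot S.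
  apply: pot_closed_le => //; first by rewrite subsetI hSP subsetUl.
  apply: leq_trans (leq_trans hM _); last by lia.
  by rewrite subset_leq_card // setSD // subsetIl.
have := hW y (setU11 _ _); lia.
Qed.

(* A vertex with c branches outside it could be added to S together with these
   branches, since each new edge is worth 2m and each branch costs at most 2(m-1). *)
Lemma pot_closed_branches S (P : G -> {set G}) (X : {set G}) M W v :
  pot_closed S -> (W < m)%N -> (c * M < Q)%N -> (0 < c)%N ->
  {in X, forall x, [/\ x \in P x, S \subset P x & (#|P x :\: S| <= M)%N]} ->
  {in X, forall x, pot S <= pot (P x) + (2 * W)%:Z} ->
  (#|[set x in X | adj x v & v \notin P x]| < c)%N.
Proof.
move=> Sc Wm hQ c0 hP hW; rewrite ltnNge; apply/negP.
case/(card_geqP) => s [us ss sX].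
pose Y := [set x in s].
have cY : #|Y| = c by rewrite cardsE; move/card_uniqP: us => ->.
have YX x : x \in Y -> [/\ x \in X, adj x v & v \notin P x].
  by rewrite inE => /sX; rewrite inE => /and3P[].
have hle : pot S <= pot (S :|: \bigcup_(x in Y) P x) + (#|Y| * (2 * W))%:Z.
  apply: (@pot_closed_bigcup _ _ _ M) => //; first by rewrite cY ltnW.
    by move=> x /YX[/hP[]].
  by move=> x /YX[/hW].
have x0 : exists x, x \in Y.
  by apply/set0Pn; rewrite -card_gt0 cY.
set B := S :|: _ in hle.
have vB : v \notin B.
  have [x xY] := x0.
  have [xX _ vPx] := YX _ xY; have [_ /subsetP SPx _] := hP _ xX.
  rewrite !inE negb_or (contra (SPx v)) //=; apply/bigcupP => -[z zY].
  by have [_ _ /negP] := YX _ zY.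
have YB : (#|Y| <= #|nbh v :&: B|)%N.
  rewrite subset_leq_card //; apply/subsetP => x xY.
  have [xX xv _] := YX _ xY; have [xP _ _] := hP _ xX.
  rewrite !inE adj_sym xv; apply/orP; right; apply/bigcupP; by exists x.
have hb := pot_setU1 vB.
suff : pot (v |: B) < pot S.
  have /(leq_mul (leqnn (2 * m)%N)) := YB; rewrite cY in hle *.
  have : (c * (2 * W) + 2 * c <= 2 * m * c)%N.
    by have := leq_mul (leqnn (2 * c)%N) Wm; rewrite mulnS; lia.
  by lia.
have Sv : S \subset v |: B by rewrite subsetU // subsetUl orbT.
apply: Sc => //.
  apply: contra vB => /eqP h; rewrite inE; by rewrite -{1}h setU11.
have sub : (v |: B) :\: S \subset v |: \bigcup_(x in Y) (P x :\: S).
  apply/subsetP => z; rewrite !inE => /andP[zS /or3P[->//||]]; first by rewrite (negPf zS).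
  case/bigcupP => x xY zP; apply/orP; right; apply/bigcupP; exists x => //.
  by rewrite inE zS.
(* The vertex [v] itself adds one to [c * M], hence the strict inequality in the hypothesis on
   [Q]. *)
apply: leq_trans hQ; apply: leq_trans (subset_leq_card sub) _.
rewrite cardsU1 -add1n leq_add ?leq_b1 // -cY.
apply: (@leq_trans (\sum_(x in Y) #|P x :\: S|)%N).
  apply: (big_ind2 (fun (A : {set G}) n => #|A| <= n)%N) => //; first by rewrite cards0.
  move=> A1 n1 A2 n2 h1 h2; apply: leq_trans (leq_add h1 h2).
  by rewrite cardsU leq_subr.
rewrite -sum_nat_const; apply: leq_sum => x /YX[/hP[]] //.
Qed.

End Potential.

(** * The expansion argument *)

(** Double counting of the pairs [w \in C x]; the maximum over [V0] is at least the average. *)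
Lemma popular_element (T : finType) (Z V0 : {set T}) (C : T -> {set T}) (delta : nat) :
  V0 != set0 -> {in Z, forall x, C x \subset V0 /\ (delta <= #|C x|)%N} ->
  exists v, (delta * #|Z| <= #|V0| * #|[set x in Z | v \in C x]|)%N.
Proof.
move=> V0n hC.
have [v vV0] := set0Pn _ V0n.
pose f w := #|[set x in Z | w \in C x]|.
have hsum : (delta * #|Z| <= \sum_(w in V0) f w)%N.
  have -> : (\sum_(w in V0) f w = \sum_(x in Z) #|C x|)%N.
    under eq_bigr => w _ do rewrite /f -sum1_card.
    under [RHS]eq_bigr => x _ do rewrite -sum1_card.
    rewrite (exchange_big_dep (mem Z)) /=; last by move=> w x _; rewrite inE => /andP[].
    apply: eq_bigr => x xZ; apply: eq_bigl => w.
    rewrite inE xZ /=; case: (boolP (w \in C x)) => [|_]; last by rewrite andbF.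
    by rewrite andbT; have [/subsetP h _] := hC x xZ; move=> /h.
  by rewrite mulnC -sum_nat_const; apply: leq_sum => x /hC[].
exists [arg max_(w > v in V0) f w]; case: arg_maxnP => // w wV0 hw.
by apply: leq_trans hsum _; rewrite -sum_nat_const; apply: leq_sum => x /hw.
Qed.

(** While fewer than half of the sets are hit, a popular element of the unhit ones hits at least
    [delta * #|X| / (2 * #|V0|)] new ones. This is the source of the factor 2. *)
Lemma greedy_hitting (T : finType) (X V0 : {set T}) (C : T -> {set T}) (delta u : nat) :
  {in X, forall x, C x \subset V0 /\ (delta <= #|C x|)%N} -> (u * delta <= #|V0|)%N ->
  exists2 U : {set T}, (#|U| <= u)%N &
    (u * delta * #|X| <= 2 * #|V0| * #|[set x in X | C x :&: U != set0]|)%N.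
Proof.
move=> hC; elim: u => [|u IH] hu.
  by exists set0; rewrite ?cards0 ?mul0n.
have V0u : (u * delta <= #|V0|)%N by apply: leq_trans hu; rewrite leq_mul2r leqnSn orbT.
have [V00|V0n] := eqVneq V0 set0.
  by exists set0; rewrite ?cards0 //; move: hu; rewrite V00 cards0 leqn0 => /eqP->.
have [U Uu] := IH V0u; set H := [set x in X | _] => hH.
pose Z := X :\: H.
have hCZ : {in Z, forall x, C x \subset V0 /\ (delta <= #|C x|)%N}.
  by move=> x; rewrite inE => /andP[_ /hC].
have [v hv] := popular_element V0n hCZ.
exists (v |: U); first by rewrite cardsU1 -add1n leq_add ?leq_b1.
set H' := [set x in X | _].
have HX : H \subset X by apply/subsetP => x; rewrite inE => /andP[].
have cX : #|X| = (#|H| + #|Z|)%N by rewrite -(cardsID H X) (setIidPr HX).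
set Y := [set x in Z | _] in hv.
have hH' : (#|H| + #|Y| <= #|H'|)%N.
  rewrite -cardsUI (_ : H :&: Y = set0) ?cards0 ?addn0.
    apply/subset_leq_card/subsetP => x; rewrite !inE => /orP[/andP[-> h]|].
      by apply: contra h; rewrite setIUr setU_eq0 => /andP[].
    case/andP => /andP[_ ->] vx; apply/set0Pn; exists v; by rewrite !inE vx eqxx.
  by apply/setP => x; rewrite !inE; case: (x \in X); case: (C x :&: U == set0).
(* Once half of [X] is hit, the claim follows from the upper bound on [u * delta] alone. *)
have [big|small] := leqP #|X| (2 * #|H|).
  apply: leq_trans (leq_mul hu (leqnn _)) _.
  rewrite mulnAC [leqLHS]mulnC leq_mul2r; apply/orP; right.
  by apply: leq_trans big _; rewrite leq_mul2l; lia.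
have : (2 * #|V0| * (#|H| + #|Y|) <= 2 * #|V0| * #|H'|)%N by rewrite leq_mul2l hH' orbT.
apply: leq_trans.
have : (delta * #|X| <= 2 * (delta * #|Z|))%N by rewrite mulnCA leq_mul2l; lia.
by rewrite mulnDr [(u.+1 * _)%N]mulSn mulnDl; lia.
Qed.

(** An inclusion-maximal superset of size at most [Bnd] and potential at least [pot m c S] works:
    extensions within the size bound are excluded by maximality, those crossing it by hypothesis. *)
Lemma pot_closed_exists (G : sgraph) (m c Q Bnd : nat) (S : {set G}) :
  (#|S| <= Bnd)%N ->
  (forall P : {set G}, S \subset P -> (Bnd < #|P| <= Bnd + Q)%N -> pot m c P < pot m c S) ->
  exists S' : {set G}, [/\ S \subset S', (#|S'| <= Bnd)%N, pot m c S <= pot m c S' &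
    pot_closed m c Q S'].
Proof.
move=> hS hP.
pose good (A : {set G}) := (pot m c S <= pot m c A) && (#|A| <= Bnd)%N.
have /maxset_exists[S' mS' SS'] : good S by rewrite /good lexx.
have [/andP[h1 h2] hmax] := maxsetP mS'.
exists S'; split=> // P SP PS hQ.
rewrite ltNge; apply/negP => hle.
have [hPB|hPB] := leqP #|P| Bnd.
  move/eqP: PS; apply; apply: hmax => //.
  by rewrite /good hPB (le_trans h1).
have := hP P (subset_trans SS' SP); rewrite hPB /=.
have -> : (#|P| <= Bnd + Q)%N.
  by have := cardsID S' P; rewrite (setIidPr SP); lia.
by move=> /(_ isT); rewrite ltNge (le_trans h1 hle).
Qed.

(** * The iteration, run under the assumption that no small dense set exists *)

Section Core.
Variables (R : realFieldType) (G : sgraph) (V0 : {set G}) (m a u delta : nat) (D : R).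
Let c := (m + a)%N.
(** Cap on the closed sets. At most [a + 1] leaf steps occur, each costing at most [2 * c * u] of
    potential, so the total cost is at most [2 * Bnd]. *)
Let Bnd := (c * a.+1 * u)%N.
(** Room for one vertex together with [c] branches of at most [m] vertices each. *)
Let Q := (c * m).+1.
(** Guaranteed size of [X] after [k] expansions and [l] leaf steps, that is, replacements of [S] by
    a closed set containing [S] and [U]. *)
Let target k l : R := #|V0|%:R * D ^+ k * (u%:R * D / #|V0|%:R) ^+ l.

Hypotheses (m0 : (0 < m)%N) (u0 : (0 < u)%N) (D0 : 0 < D).
Hypothesis V0n : V0 != set0.
Hypothesis mindeg : {in V0, forall x, (delta + c + m <= #|nbh x :&: V0|)%N}.
Hypothesis hu : (u * delta <= #|V0|)%N.
(** An expansion loses a factor [c] to multiplicity. A leaf step loses 2 in the greedy choice and 2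
    in discarding the new closed set. *)
Hypothesis hD : (4 * c)%:R * D <= delta%:R.
(** The condition on [k] and [l] says that [W] is nonnegative, given the invariant
    [W + l * m = m + k.+1 * a] of the iteration. *)
Hypothesis htarget : forall k l, (k < m)%N -> (0 < l)%N -> (l * m <= m + k.+1 * a)%N ->
  Bnd%:R <= target k l.
(** The inequality is [pot m c A < - 2 * #|A|], written without subtraction of integers. *)
Hypothesis sparse : forall A : {set G}, A != set0 -> (#|A| <= Bnd + u + Q)%N ->
  (m * darts A < 2 * c.-1 * #|A|)%N.

(** The lower bound on [pot m c S] serves to keep [S] small, since sets larger than [Bnd] have a
    lower potential. *)
Record state (k l W : nat) (S X : {set G}) (P : G -> {set G}) : Prop := State {
  state_closed : pot_closed m c Q S;
  state_size : (#|S| <= Bnd)%N;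
  state_pot : - (2 * c * (l * u))%:Z <= pot m c S;
  state_sub : X \subset V0;
  state_card : target k l <= #|X|%:R;
  state_branch : {in X, forall x, [/\ x \notin S, x \in P x, S \subset P x &
    (#|P x :\: S| <= k.+1)%N]};
  state_deficit : {in X, forall x, pot m c S <= pot m c (P x) + (2 * W)%:Z} }.

Lemma core_c_gt0 : (0 < c)%N. Proof. by rewrite /c addn_gt0 m0. Qed.

Lemma core_card_gt0 : 0 < #|V0|%:R :> R. Proof. by rewrite ltr0n card_gt0. Qed.

Lemma target_gt0 k l : 0 < target k l.
Proof.
have V0p := core_card_gt0.
by rewrite mulr_gt0 ?mulr_gt0 ?exprn_gt0 // divr_gt0 ?mulr_gt0 // ltr0n.
Qed.

Lemma sparse_pot (A : {set G}) : A != set0 -> (#|A| <= Bnd + u + Q)%N ->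
  pot m c A < - (2 * #|A|)%:Z.
Proof.
have cp := core_c_gt0.
move=> An /(sparse An); rewrite /pot -[in X in (_ < X)%N]subn1 mulnBr mulnBl.
have : (2 * #|A| <= 2 * c * #|A|)%N by rewrite leq_mul2r leq_pmulr ?orbT.
lia.
Qed.

(** Closedness allows fewer than [c] neighbours in [S], and the rest of [P x] has at most [m]
    vertices; the slack [c + m] in [mindeg] pays for both. *)
Lemma state_nbh k l W S X P x : state k l W S X P -> (k < m)%N -> x \in X ->
  (delta <= #|(nbh x :&: V0) :\: P x|)%N.
Proof.
move=> st km xX; have [xS xP SP hP] := state_branch st xX.
have xV0 := subsetP (state_sub st) _ xX.
have h1 := pot_closed_nbh m0 (isT : (0 < Q)%N) (state_closed st) xS.
have h2 := mindeg xV0.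
have h3 := cardsID (P x) (nbh x :&: V0).
suff : (#|nbh x :&: V0 :&: P x| <= #|nbh x :&: S| + #|P x :\: S|)%N by lia.
apply: leq_trans (_ : #|(nbh x :&: S) :|: (P x :\: S)| <= _)%N.
  apply/subset_leq_card/subsetP => z; rewrite !inE => /andP[/andP[-> _] ->].
  by case: (z \in S).
by rewrite cardsU leq_subr.
Qed.

(** Adding [v] to [P x] gains [2 * m] from the edge to [x] and costs [2 * c], so the deficit [2 * W]
    grows by [2 * a]. *)
Lemma state_expand k l W S X P : state k l W S X P -> (W < m)%N -> (k.+1 < m)%N ->
  exists X' P', state k.+1 l (W + a) S X' P'.
Proof.
move=> st Wm km; have cp := core_c_gt0.
pose ok v x := [&& x \in X, adj x v & v \notin P x].
pose X' := [set v in V0 | [exists x, ok v x]].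
(* One admissible predecessor is picked for each [v]; the default [set0] never occurs for [v] in
   [X']. *)
pose P' v := v |: odflt set0 (omap P [pick x | ok v x]).
have hok v : v \in X' -> exists2 x, ok v x & P' v = v |: P x.
  rewrite inE => /andP[_ /existsP[x okx]]; rewrite /P'.
  by case: pickP => [y|/(_ x)]; [exists y | rewrite okx].
have cW : {in X, forall x, [/\ x \in P x, S \subset P x & (#|P x :\: S| <= k.+1)%N]}.
  by move=> x /(state_branch st)[].
have hQ : (c * k.+1 < Q)%N by rewrite ltnS leq_mul2l ltnW ?orbT.
have few v := pot_closed_branches v (state_closed st) Wm hQ cp cW (state_deficit st).
(* Double counting: each [x] has at least [delta] successors, and by [few] each [v] has fewer than
   [c] predecessors. *)
have count : (delta * #|X| <= c * #|X'|)%N.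
  apply: (@leq_trans (\sum_(x in X) #|(nbh x :&: V0) :\: P x|)).
    rewrite mulnC -sum_nat_const; apply: leq_sum => x.
    by apply: (state_nbh st); exact: ltnW.
  rewrite [leqRHS]mulnC -sum_nat_const.
  have -> : (\sum_(x in X) #|(nbh x :&: V0) :\: P x| =
     \sum_(v in X') #|[set x in X | adj x v & v \notin P x]|)%N.
    under eq_bigr => x _ do rewrite -sum1_card.
    under [RHS]eq_bigr => x _ do rewrite -sum1_card.
    rewrite (exchange_big_dep (mem X')) /=.
      apply: eq_bigr => v; rewrite inE => /andP[vV0 _]; apply: eq_bigl => x.
      by rewrite !inE vV0 andbT [_ && adj x v]andbC.
    move=> x v xX; rewrite !inE => /andP[vP /andP[xv ->]].
    by apply/existsP; exists x; rewrite /ok xX xv.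
  by apply: leq_sum => v _; exact: ltnW.
exists X', P'; split.
- exact: state_closed st.
- exact: state_size st.
- exact: state_pot st.
- by apply/subsetP => v; rewrite inE => /andP[].
- have cR : 0 < c%:R :> R by rewrite ltr0n.
  rewrite -(ler_pM2l cR) -natrM; apply: le_trans (_ : (delta * #|X|)%:R <= _); last by rewrite ler_nat.
  rewrite natrM; apply: le_trans (ler_wpM2l _ (state_card st)); last by [].
  have -> : target k.+1 l = D * target k l by rewrite /target exprS; ring.
  rewrite mulrA ler_wpM2r ?(ltW (target_gt0 _ _)) //.
  apply: le_trans hD; rewrite ler_wpM2r ?(ltW D0) // ler_nat leq_pmull //.
- move=> v vX'; have [x /and3P[xX xv vP] ->] := hok v vX'.
  have [xS xP SP hP] := state_branch st xX; split.
  + by apply: contra vP; apply: (subsetP SP).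
  + exact: setU11.
  + by rewrite subsetU // SP orbT.
  + rewrite setDUl; apply: leq_trans (_ : #|[set v] :\: S| + #|P x :\: S| <= _)%N.
      by rewrite cardsU leq_subr.
    rewrite -[k.+2]add1n leq_add //.
    by rewrite -(cards1 v) subset_leq_card // subsetDl.
- move=> v vX'; have [x /and3P[xX xv vP] ->] := hok v vX'.
  have [xS xP SP hP] := state_branch st xX.
  have := state_deficit st xX; have := pot_setU1 m c vP.
  have : (2 * m <= 2 * m * #|nbh v :&: P x|)%N.
    rewrite leq_pmulr // card_gt0; apply/set0Pn; exists x.
    by rewrite !inE adj_sym xv.
  rewrite /c; clear; lia.
Qed.

Lemma state_leaf k l W S X P : state k l W S X P -> (m <= W)%N -> (k < m)%N -> (l <= a)%N ->
  Bnd%:R <= target k l.+1 ->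
  exists S' X' P', state k l.+1 (W - m) S' X' P'.
Proof.
move=> st Wm km la htg; have cp := core_c_gt0; have V0p := core_card_gt0.
pose C x := (nbh x :&: V0) :\: P x.
have hC : {in X, forall x, C x \subset V0 /\ (delta <= #|C x|)%N}.
  move=> x xX; split; last exact: (state_nbh st).
  by rewrite /C subDset subsetU // subsetIr orbT.
have [U Uu] := greedy_hitting hC hu; set H := [set x in X | _] => hH.
have potSU : - (2 * c * (l.+1 * u))%:Z <= pot m c (S :|: U).
  have := state_pot st; have := pot_setU m c S U.
  have : (2 * c * #|U| <= 2 * c * u)%N by rewrite leq_mul2l Uu orbT.
  rewrite mulSn mulnDr; lia.
(* Here [l <= a] enters: the potential is below [- 2 * Bnd], hence below what [S :|: U] retains. So
   neither [S :|: U] nor its closed extension can outgrow [Bnd]. *)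
have dense (A : {set G}) : (Bnd < #|A| <= Bnd + u + Q)%N -> pot m c A < - (2 * c * (l.+1 * u))%:Z.
  move=> /andP[h1 h2].
  have An : A != set0 by rewrite -card_gt0 (leq_trans _ h1).
  apply: lt_le_trans (sparse_pot An h2) _; rewrite lerN2 lez_nat.
  apply: leq_trans (_ : 2 * Bnd <= _)%N; last by rewrite leq_mul2l ltnW ?orbT.
  by rewrite /Bnd -!mulnA !leq_mul2l leq_mul2r ltnS la !orbT.
have szSU : (#|S :|: U| <= Bnd)%N.
  rewrite leqNgt; apply/negP => hgt.
  suff : pot m c (S :|: U) < - (2 * c * (l.+1 * u))%:Z by rewrite ltNge potSU.
  apply: dense; rewrite hgt /= cardsU; have := state_size st; lia.
have [S' [SS' szS' potS' clS']] : exists S' : {set G}, [/\ S :|: U \subset S', (#|S'| <= Bnd)%N,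
    pot m c (S :|: U) <= pot m c S' & pot_closed m c Q S'].
  apply: pot_closed_exists => // A _ /andP[h1 h2].
  apply: lt_le_trans potSU; apply: dense; rewrite h1; lia.
move: SS'; rewrite subUset => /andP[SS' US'].
exists S', (H :\: S'), (fun x => P x :|: S'); split=> //.
- exact: le_trans potSU potS'.
- apply/subsetP => x; rewrite !inE => /and3P[_ xX _]; exact: (subsetP (state_sub st)).
(* Discarding [S'] loses at most [Bnd], which is at most the new target, so it suffices that [H] has
   twice that target. *)
- have hX' : (#|H| <= #|H :\: S'| + Bnd)%N.
    by rewrite -(cardsID S' H) addnC leq_add2l (leq_trans _ szS') // subset_leq_card // subsetIr.
  have {}hX' : #|H|%:R <= #|H :\: S'|%:R + Bnd%:R :> R by rewrite -natrD ler_nat.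
  suff : 2 * target k l.+1 <= #|H|%:R by lra.
  have tE : target k l.+1 = u%:R * D / #|V0|%:R * target k l by rewrite /target exprS; ring.
  have {}hH : u%:R * delta%:R * #|X|%:R <= 2 * #|V0|%:R * #|H|%:R :> R.
    by rewrite -!natrM ler_nat.
  have h4D : 4 * D <= delta%:R.
    apply: le_trans hD; rewrite ler_wpM2r ?(ltW D0) // ler_nat leq_pmulr //.
  have hX := state_card st.
  have tp := target_gt0 k l.
  have h1 : u%:R * (4 * D) * target k l <= u%:R * delta%:R * #|X|%:R.
    apply: ler_pM => //; first by rewrite !mulr_ge0 // ltW.
      exact: ltW.
    by rewrite ler_wpM2l.
  have V2 : 0 < 2 * #|V0|%:R :> R by rewrite mulr_gt0.
  rewrite -(ler_pM2l V2); apply: le_trans hH; apply: le_trans h1.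
  rewrite tE le_eqVlt; apply/orP; left; apply/eqP.
  move: (target k l) (lt0r_neq0 V0p) => t V00; field; exact: V00.
- move=> x; rewrite !inE => /and3P[xS' xX _].
  have [xS xP SP hP] := state_branch st xX; split.
  + exact: xS'.
  + by rewrite xP.
  + exact: subsetUr.
  + apply: leq_trans hP; rewrite /= setDUl setDv setU0.
    by apply/subset_leq_card/setDS.
- move=> x; rewrite !inE => /and3P[xS' xX /set0Pn[y]].
  rewrite /C !inE => /andP[/and3P[yP xy _] yU].
  have [xS xP SP hP] := state_branch st xX.
  have yS' := subsetP US' _ yU.
  (* The edge from [x] to a vertex [y] of [U] outside [P x] is worth [2 * m], and the intersection
     of [P x] with [S'] has potential at most [pot m c S]. Thus the deficit drops by [2 * m]. *)
  have := pot_supermodular_edge m c xP xS' yS' yP xy.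
  have := state_deficit st xX.
  have : pot m c (P x :&: S') <= pot m c S.
    apply: (pot_closed_le (state_closed st)); first by rewrite subsetI SP.
    apply: leq_trans (_ : k.+1 <= _)%N.
      by apply: leq_trans hP; rewrite subset_leq_card // setSD // subsetIl.
    rewrite /Q ltnS (leq_trans (ltnW km)) // leq_pmull //.
  clear -Wm; lia.
Qed.

(** Induction on the measure [(m - k) * a.+1 + W]: an expansion lowers the product by [a + 1] and
    raises [W] by [a], while a leaf step lowers [W] by [m]. Both preserve the equation for [W]. *)
Lemma state_absurd N k l W S X P : state k l W S X P -> (k < m)%N ->
  (W + l * m = m + k.+1 * a)%N -> ((m - k) * a.+1 + W < N)%N -> False.
Proof.
elim: N k l W S X P => // N IH k l W S X P st km WE; rewrite ltnS => hN.
have [x xX] : exists x, x \in X.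
  apply/set0Pn; rewrite -card_gt0 -(ltr0n R).
  exact: lt_le_trans (target_gt0 k l) (state_card st).
have [Wm|mW] := ltnP W m; last first.
  have la : (l <= a)%N.
    rewrite -(leq_pmul2r m0) -(leq_add2l m).
    have : (k.+1 * a <= a * m)%N by rewrite mulnC leq_mul2l km orbT.
    lia.
  have [|S' [X' [P' st']]] := state_leaf st mW km la.
    by apply: htarget => //; rewrite mulSn; lia.
  apply: (IH _ _ _ _ _ _ st') => //; first by rewrite mulSn; lia.
  lia.
(* With deficit zero, [P x] is a proper extension of the closed set [S] that does not lower the
   potential. *)
have [W0|W0] := posnP W.
  have [xS xP SP hP] := state_branch st xX.
  have := state_deficit st xX; rewrite W0 muln0 addr0 leNgt => /negP; apply.
  apply: (state_closed st) => //.
    by apply: contra xS => /eqP <-.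
  by rewrite (leq_trans hP) // /Q leqW // (leq_trans km) // leq_pmull ?core_c_gt0.
have [k1|k1] := ltnP k.+1 m; last first.
  have km1 : k.+1 = m by apply/eqP; rewrite eqn_leq km k1.
  rewrite km1 in WE.
  have : (m %| W)%N.
    have : (m %| W + l * m)%N by rewrite WE dvdn_addr // dvdn_mulr.
    by rewrite dvdn_addl // dvdn_mull.
  by move/(dvdn_leq W0); rewrite leqNgt Wm.
have [X' [P' st']] := state_expand st Wm k1.
apply: (IH _ _ _ _ _ _ st') => //; first by rewrite mulSn; lia.
have : ((m - k) = (m - k.+1).+1)%N by lia.
by move=> e; move: hN; rewrite e mulSn; lia.
Qed.

(** The iteration starts with [S] empty, each [P x] a singleton of potential [- 2 * c], and [W = c].
    Sparsity makes the empty set closed. *)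
Lemma core_absurd : False.
Proof.
have cp := core_c_gt0.
apply: (@state_absurd ((m - 0) * a.+1 + c).+1 0 0 c set0 V0 (fun x => [set x])) => //; last first.
  by rewrite mul0n mul1n addn0.
split=> //.
- move=> A _ An; rewrite setD0 pot0 => hA.
  have := @sparse_pot A An; lia.
- by rewrite cards0.
- by rewrite pot0 mul0n muln0 oppr0.
- by rewrite /target !expr0 !mulr1.
- by move=> x _; split; rewrite ?inE ?sub0set // setD0 cards1.
- move=> x _; rewrite pot0 /pot cards1; lia.
Qed.

End Core.

Lemma dense_set_exists (R : realFieldType) (G : sgraph) (V0 : {set G})
    (m a u delta : nat) (D : R) (c := (m + a)%N) :
  (0 < m)%N -> (0 < u)%N -> 0 < D -> V0 != set0 ->
  {in V0, forall x, (delta + c + m <= #|nbh x :&: V0|)%N} ->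
  (u * delta <= #|V0|)%N -> (4 * c)%:R * D <= delta%:R ->
  (forall k l, (k < m)%N -> (0 < l)%N -> (l * m <= m + k.+1 * a)%N ->
    (c * a.+1 * u)%:R <= #|V0|%:R * D ^+ k * (u%:R * D / #|V0|%:R) ^+ l) ->
  exists A : {set G}, [/\ A != set0, (#|A| <= c * a.+1 * u + u + (c * m).+1)%N &
    (2 * c.-1 * #|A| <= m * darts A)%N].
Proof.
move=> m0 u0 D0 V0n hdeg hu hD htg.
pose ok (A : {set G}) := [&& A != set0, (#|A| <= c * a.+1 * u + u + (c * m).+1)%N &
    (2 * c.-1 * #|A| <= m * darts A)%N].
have [/existsP[A /and3P[]]|/existsPn hno] := boolP [exists A, ok A]; first by exists A.
exfalso; apply: (core_absurd m0 u0 D0 V0n hdeg hu hD htg) => A An hA.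
by have := hno A; rewrite /ok An hA /= -ltnNge.
Qed.

(** * Average and minimum degree *)

Lemma degree_induced (G : sgraph) (A : {set G}) (x : induced_subgraph A) :
  degree x = #|nbh (val x) :&: A|.
Proof.
rewrite /degree -(card_imset _ val_inj); congr #|pred_of_set _|.
apply/setP => y; rewrite !inE; apply/imsetP/andP => [[z + ->]|[xy yA]].
  by rewrite inE => xz; split=> //; exact: valP.
by exists (exist _ y yA); rewrite // inE.
Qed.

Lemma avg_degree_induced (R : realType) (G : sgraph) (A : {set G}) :
  avg_degree R (induced_subgraph A) = (darts A)%:R / #|A|%:R.
Proof.
rewrite /avg_degree -natr_sum card_sig dartsE; congr (_%:R / _).
rewrite (big_sub (mem A) (fun x => #|nbh x :&: A|)).
by apply: eq_bigr => x _; rewrite degree_induced.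
Qed.

Lemma avg_degreeE (R : realType) (G : sgraph) :
  avg_degree R G = (darts [set: G])%:R / #|G|%:R.
Proof.
rewrite /avg_degree -natr_sum dartsE; congr (_%:R / _).
rewrite [RHS](eq_bigl xpredT) => [|x]; last by rewrite inE.
by apply: eq_bigr => x _; rewrite setIT.
Qed.

(** A maximiser of [darts A - 2 * delta * #|A|] works, since deleting a vertex of degree below
    [delta] would increase this quantity. *)
Lemma large_min_degree (G : sgraph) (delta : nat) :
  (2 * delta * #|G| < darts [set: G])%N ->
  exists2 V0 : {set G}, V0 != set0 & {in V0, forall x, (delta <= #|nbh x :&: V0|)%N}.
Proof.
move=> hG; pose f (A : {set G}) : int := (darts A)%:Z - (2 * delta * #|A|)%:Z.
have fT : 0 < f [set: G] by rewrite /f subr_gt0 ltz_nat cardsT.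
have [V0 _ hmax] := arg_maxP f (isT : xpredT [set: G]).
exists V0 => [|x xV0].
  apply/eqP => V00; have := lt_le_trans fT (hmax [set: G] isT).
  by rewrite V00 /f cards0 muln0 dartsE big_set0.
rewrite leqNgt; apply/negP => hlt.
have hsub : (#|nbh x :&: (V0 :\ x)| <= #|nbh x :&: V0|)%N.
  by rewrite subset_leq_card // setIS // subsetDl.
have dE : darts V0 = (darts (V0 :\ x) + 2 * #|nbh x :&: (V0 :\ x)|)%N.
  by rewrite -darts_setU1 ?setD1K // setD11.
have := hmax (V0 :\ x) isT; rewrite /f dE (cardsD1 x V0) xV0 mulnDr.
clear -hlt hsub; lia.
Qed.

(** * Choice of the parameters *)

Lemma powR_expR (R : realType) (x r : R) : 0 < x -> x `^ r = expR (r * ln x).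
Proof. by move=> x0; rewrite /powR gt_eqF. Qed.

Lemma powR_le_expR (R : realType) (C e : R) : 0 <= C -> 0 < e ->
  exists L0, forall L, L0 <= L -> L `^ C <= expR (e * L).
Proof.
move=> C0 e0; exists (1 + (2 * C / e) ^+ 2) => L hL.
have L0 : 0 < L by have := sqr_ge0 (2 * C / e); lra.
rewrite powR_expR // ler_expR.
(* With [L = r ^+ 2] the bound [ln r <= r] gives [ln L <= 2 * r], which is sublinear in [L]. *)
set r := Num.sqrt L; have LE : L = r ^+ 2 by rewrite sqr_sqrtr // ltW.
have r0 : 0 < r by rewrite sqrtr_gt0.
have hr : 2 * C / e <= r.
  rewrite -ler_sqr ?nnegrE ?divr_ge0 ?mulr_ge0 ?(ltW e0) ?(ltW r0) // -LE; lra.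
have hl : ln L <= 2 * r.
  by rewrite LE lnXn // -[ln r *+ 2]mulr_natl ler_wpM2l // ltW // ln_sublinear.
apply: le_trans (ler_wpM2l C0 hl) _.
rewrite LE; move: hr; rewrite ler_pdivrMr // => hr.
rewrite expr2 (_ : C * (2 * r) = 2 * C * r); last by ring.
by rewrite mulrA ler_wpM2r ?(ltW r0) // [e * r]mulrC.
Qed.

(** This is [htarget] for [l + 1] leaf steps after cancelling one factor [u], with [q] for
    [u / #|V0|]. The exponent of [D] is at least [k + 1 - l * m / a], which is nonnegative; a factor
    [B] comes from [B ^+ l], or from [B <= D] if [l = 0]. *)
Lemma scale_power_bound (R : realType) (B D q : R) (m a k l : nat) :
  (0 < a)%N -> 1 <= B -> B <= D -> B * D `^ (- (1 + m%:R / a%:R)) <= q ->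
  (l * m <= k.+1 * a)%N ->
  B <= D ^+ (k + l.+1) * q ^+ l.
Proof.
move=> a0 B1 BD hq hl; have D1 := le_trans B1 BD.
have D0 : 0 < D by lra.
case: l hl => [|l] hl.
  rewrite mulr1 (le_trans BD) // addn1 -[leLHS]expr1 ler_weXn2l //.
have p0 : 0 <= B * D `^ (- (1 + m%:R / a%:R)) by rewrite mulr_ge0 ?powR_ge0 //; lra.
apply: (@le_trans _ _ (D ^+ (k + l.+2) * (B * D `^ (- (1 + m%:R / a%:R))) ^+ l.+1)); last first.
  by rewrite ler_wpM2l ?exprn_ge0 ?(ltW D0) // lerXn2r // nnegrE // (le_trans p0).
rewrite exprMn mulrCA -[leLHS]mulr1 ler_pM //; try lra.
  by rewrite -[leLHS]expr1 ler_weXn2l.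
rewrite -!powR_mulrn ?powR_ge0 ?(ltW D0) // -powRrM -powRD; last first.
  by rewrite (gt_eqF D0) implybT.
rewrite -[leLHS](powRr0 D) ler_powR //.
have aR : 0 < a%:R :> R by rewrite ltr0n.
have h : l.+1%:R * m%:R / a%:R <= k.+1%:R :> R.
  by rewrite ler_pdivrMr // -!natrM ler_nat.
move: h; rewrite -mulrA addnS -addSn natrD; move: (m%:R / a%:R) k.+1%:R l.+1%:R => r x y; lra.
Qed.

(** The exponents [m / a] and [sigma^-1] differ by at most [2 / (sigma ^+ 2 * m)], and [ln d <= m],
    so exchanging them costs a constant factor. *)
Lemma scale_bound (R : realType) (sigma d y : R) (m a : nat) :
  0 < sigma -> (0 < m)%N -> sigma * m%:R <= a%:R <= sigma * m%:R + 2 -> ln d <= m%:R ->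
  0 < y -> 1 <= y -> y <= d ->
  (d / y) `^ (- (1 + m%:R / a%:R)) <=
    expR (2 / sigma ^+ 2) * y `^ (1 + sigma^-1) * d `^ (- (1 + sigma^-1)).
Proof.
move=> sigma0 m0 /andP[ma1 ma2] hm y0 y1 yd.
have d0 : 0 < d by lra.
have mR : 0 < m%:R :> R by rewrite ltr0n.
have aR : 0 < a%:R :> R by apply: lt_le_trans ma1; rewrite mulr_gt0.
rewrite !powR_expR ?divr_gt0 // -!expRD ler_expR ln_div ?posrE //.
have hD : 0 <= ln d - ln y by rewrite subr_ge0 ler_ln ?posrE.
have hy : 0 <= ln y by rewrite ln_ge0.
have hr : sigma^-1 - m%:R / a%:R <= 2 / (sigma ^+ 2 * m%:R).
  rewrite -subr_ge0.
  (* The numerator is split so that each bound on [a] makes one summand nonnegative. *)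
  have -> : 2 / (sigma ^+ 2 * m%:R) - (sigma^-1 - m%:R / a%:R) =
     (2 * (a%:R - sigma * m%:R) + sigma * m%:R * (sigma * m%:R + 2 - a%:R)) / (sigma ^+ 2 * m%:R * a%:R).
    by field; rewrite ?lt0r_neq0.
  apply: divr_ge0; last by rewrite !mulr_ge0 ?exprn_ge0 // ltW.
  by rewrite addr_ge0 // ?mulr_ge0 ?subr_ge0 // ltW.
have hr0 : 0 <= sigma^-1 - m%:R / a%:R.
  by rewrite subr_ge0 ler_pdivrMr // mulrC ler_pdivlMr // mulrC.
have key : (sigma^-1 - m%:R / a%:R) * (ln d - ln y) <= 2 / sigma ^+ 2.
  have -> : 2 / sigma ^+ 2 = 2 / (sigma ^+ 2 * m%:R) * m%:R by field; rewrite !lt0r_neq0.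
  by apply: ler_pM => //; lra.
lra.
Qed.

(* The constant expR e pays for replacing 1/sigma by m/a, and the exponent
   5 + 1/sigma absorbs all polynomial losses in m and a. *)
Lemma parameters_exist (R : realType) (sigma e : R) : 0 < sigma -> 0 <= e ->
  exists C d0 : R, forall d, d0 <= d -> 1 < d /\ exists m a : nat,
   let E := expR e * (32 * (m + a)%:R) `^ (5 + sigma^-1) in
   [/\ (0 < m)%N, sigma * m%:R + 1 <= a%:R <= sigma * m%:R + 2, ln d <= m%:R &
       [/\ E <= ln d `^ C, E <= d & E <= d `^ sigma^-1]].
Proof.
move=> sigma0 e0; have si0 : 0 < sigma^-1 by rewrite invr_gt0.
(* One power of [ln d] more than in [E], to absorb the constant [L3]. *)
pose C := 6 + sigma^-1.
have C0 : 0 <= C by rewrite /C; lra.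
have [L1 hL1] := powR_le_expR C0 (ltr01 : 0 < 1 :> R).
have [L2 hL2] := powR_le_expR C0 si0.
pose g := 32 * (2 + 2 * sigma + 2).
pose L3 := expR e * g `^ (5 + sigma^-1).
pose L0 := 1 + `|L1| + `|L2| + `|L3|.
exists C, (expR L0) => d hd.
have d0 : 0 < d by apply: lt_le_trans hd; exact: expR_gt0.
have hL : L0 <= ln d by rewrite -[leLHS]expRK ler_ln ?posrE ?expR_gt0.
have := ler_norm L1; have := ler_norm L2; have := ler_norm L3.
have := normr_ge0 L1; have := normr_ge0 L2; have := normr_ge0 L3.
move=> n3 n2 n1 l3 l2 l1.
have Lge1 : 1 <= ln d by rewrite /L0 in hL; lra.
have LL1 : L1 <= ln d by rewrite /L0 in hL; lra.
have LL2 : L2 <= ln d by rewrite /L0 in hL; lra.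
have LL3 : L3 <= ln d by rewrite /L0 in hL; lra.
split.
  rewrite -[d]lnK ?posrE // -expR0 ltr_expR; lra.
set L := ln d in hL Lge1 LL1 LL2 LL3 *.
exists (Num.trunc L).+1; set m := (Num.trunc L).+1.
(* The offset 2 leaves [a] at least 1 above [sigma * m], which later pays for [c.-1] in place of
   [c]. *)
exists (Num.trunc (sigma * m%:R)).+2; set a := (Num.trunc (sigma * m%:R)).+2.
have /andP[hm1 hm2] : (Num.trunc L)%:R <= L < m%:R by apply: truncn_itv; lra.
have sm0 : 0 <= sigma * m%:R by rewrite mulr_ge0 // ltW.
have /andP[ha1 ha2] := truncn_itv sm0.
have mE : m%:R = (Num.trunc L)%:R + 1 :> R by rewrite /m -addn1 natrD.
have aE : a%:R = (Num.trunc (sigma * m%:R))%:R + 2 :> R by rewrite /a -addn2 natrD.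
have aE' : (Num.trunc (sigma * m%:R)).+1%:R = (Num.trunc (sigma * m%:R))%:R + 1 :> R by rewrite -addn1 natrD.
rewrite aE' in ha2.
have hc : 32 * (m + a)%:R <= g * L.
  rewrite natrD /g; have : sigma * m%:R <= sigma * (2 * L) by rewrite ler_wpM2l ?(ltW sigma0) //; lra.
  lra.
have hE : expR e * (32 * (m + a)%:R) `^ (5 + sigma^-1) <= L `^ C.
  apply: (@le_trans _ _ (expR e * (g * L) `^ (5 + sigma^-1))).
    rewrite ler_wpM2l ?expR_ge0 // ge0_ler_powR // ?nnegrE; [lra|by rewrite mulr_ge0|].
    by apply: le_trans hc; rewrite mulr_ge0.
  have g0 : 0 <= g by rewrite /g; lra.
  have Lge0 : 0 <= L by lra.
  rewrite powRM //.
  have CE : C = 1 + (5 + sigma^-1) by rewrite /C; ring.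
  rewrite mulrA CE [leRHS]powRD; last by rewrite implybE gt_eqF ?orbT //; lra.
  by rewrite powRr1 // ler_wpM2r ?powR_ge0 //.
split=> //.
- by apply/andP; split; lra.
- by rewrite ltW.
split=> //.
  apply: le_trans hE _; apply: le_trans (hL1 _ LL1) _.
  by rewrite mul1r lnK ?posrE.
apply: le_trans hE _; apply: le_trans (hL2 _ LL2) _.
by rewrite powR_expR.
Qed.

(** Here [d / y] will be the growth factor [D], and [p] the density [u / #|V0|] before rounding. The
    bound [p * d <= 1] will give [u * delta <= #|V0|]. *)
Lemma scale_parameters (R : realType) (sigma d : R) (m a : nat) (c := (m + a)%N)
    (y : R := 32 * c%:R) (z := expR (2 / sigma ^+ 2) * y `^ (1 + sigma^-1))
    (B : R := (c * a.+1)%:R) (p := B * (d / y) `^ (- (1 + m%:R / a%:R))) :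
  0 < sigma -> 1 < d -> (0 < m)%N -> sigma * m%:R + 1 <= a%:R <= sigma * m%:R + 2 ->
  ln d <= m%:R -> z * y ^+ 4 <= d -> z * y ^+ 4 <= d `^ sigma^-1 ->
  [/\ 1 <= z, 4096 * y <= d, B <= d / y,
      p <= B * z * d `^ (- (1 + sigma^-1)) & p * d <= 1].
Proof.
move=> sigma0 d1 m0 /andP[ma1 ma2] dm Ed Eds.
have a1 : (0 < a)%N.
  rewrite -(ltr0n R); apply: lt_le_trans ma1.
  by rewrite addr_gt0 // mulr_gt0 // ltr0n.
have c2 : 2 <= c%:R :> R by rewrite ler_nat /c; lia.
have y64 : 64 <= y by rewrite /y; lra.
have Bc : B <= c%:R ^+ 2.
  by rewrite /B natrM expr2 ler_wpM2l ?ler0n // ler_nat /c -add1n leq_add2r.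
have B1 : 1 <= B by rewrite ler1n muln_gt0 /c addn_gt0 m0.
have By : B <= y ^+ 2.
  by apply: le_trans Bc _; rewrite lerXn2r ?nnegrE ?ler0n // /y; lra.
have y0 : 0 < y by lra.
have z1 : 1 <= z.
  rewrite /z -[leLHS]mulr1 ler_pM //.
    by rewrite -[leLHS]expR0 ler_expR divr_ge0 // exprn_ge0 // ltW.
  rewrite -[leLHS](powRr0 y) ler_powR; first by [].
    by lra.
  by rewrite addr_ge0 // invr_ge0 ltW.
have z0 : 0 <= z by apply: le_trans z1.
have d0 : 0 <= d by apply/ltW/(lt_trans _ d1).
have B0 : 0 <= B by exact: le_trans B1.
have pty : y <= d -> p <= B * z * d `^ (- (1 + sigma^-1)).
  move=> yd; rewrite /p -mulrA ler_wpM2l //.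
  apply: scale_bound => //; last by apply: le_trans y64; rewrite ler1n.
  by rewrite ma2 andbT (le_trans _ ma1) // lerDl.
clearbody B y z.
have y4 : y ^+ 4 <= d.
  by apply: le_trans Ed; apply: ler_peMl => //; apply/exprn_ge0/ltW.
have y34 : y ^+ 3 <= y ^+ 4 by rewrite ler_weXn2l //; lra.
have y23 : y ^+ 2 <= y ^+ 3 by rewrite ler_weXn2l //; lra.
have yd : 4096 * y <= d.
  apply: le_trans y4; rewrite exprSr ler_wpM2r ?(ltW y0) //.
  have : (64 : R) ^+ 3 <= y ^+ 3 by rewrite lerXn2r // ?nnegrE ?(ltW y0).
  by rewrite (_ : 64 ^+ 3 = 64 * 4096 :> R); [lra | ring].
have BD : B <= d / y.
  rewrite ler_pdivlMr //; apply: le_trans y4; rewrite exprSr ler_wpM2r ?(ltW y0) //.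
  exact: le_trans By y23.
have pt : p <= B * z * d `^ (- (1 + sigma^-1)) by apply: pty; lra.
split=> //.
apply: le_trans (ler_wpM2r d0 pt) _.
have -> : B * z * d `^ (- (1 + sigma^-1)) * d = B * z * (d `^ (- (1 + sigma^-1)) * d) by ring.
have -> : d `^ (- (1 + sigma^-1)) * d = (d `^ sigma^-1)^-1.
  rewrite -{2}(powRr1 d0) -powRD; last by rewrite implybE [d == _]gt_eqF ?orbT // (lt_trans ltr01 d1).
  by rewrite -powRN; congr (_ `^ _); ring.
rewrite ler_pdivrMr ?mul1r; last exact: powR_gt0 (lt_trans ltr01 d1).
apply: le_trans Eds; rewrite mulrC; apply: ler_wpM2l => //.
exact: le_trans By (le_trans y23 y34).
Qed.

(** The left side is the size [Bnd + u + Q] of the dense set. As [n * t >= 1], the additive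
    constants are absorbed into multiples of [n * t * z]. *)
Lemma size_bound (R : realFieldType) (B c m n p t u z : R) :
  2 <= c -> m <= c -> 0 <= B -> B <= c ^+ 2 -> 1 <= z -> 0 <= n -> 1 <= n * t ->
  p <= B * z * t -> u <= n * p + 1 ->
  B * u + u + (c * m + 1) <= n * t * (z * (32 * c) ^+ 4).
Proof.
move=> c2 mc B0 Bc z1 n0 T1 hp hu.
have hnp : n * p <= B * (n * t * z).
  by apply: le_trans (ler_wpM2l n0 hp) _; rewrite le_eqVlt; apply/orP; left; apply/eqP; ring.
rewrite mulrA; have : 1 <= n * t * z by rewrite -[leLHS]mulr1 ler_pM.
move: (n * t * z) hnp => T hnp {}T1.
have huT : u <= (B + 1) * T by lra.
have cm : c * m + 1 <= (c ^+ 2 + 1) * T.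
  have : c * m <= c ^+ 2 by rewrite expr2 ler_wpM2l //; lra.
  have := sqr_ge0 c; nra.
have BuT : (B + 1) * u <= (c ^+ 2 + 1) ^+ 2 * T.
  apply: le_trans (ler_wpM2l _ huT) _; first by lra.
  rewrite mulrA -expr2; apply: ler_wpM2r; first by lra.
  have c20 := sqr_ge0 c.
  by apply: lerXn2r; rewrite ?nnegrE; lra.
have : ((c ^+ 2 + 1) ^+ 2 + (c ^+ 2 + 1)) * T <= (32 * c) ^+ 4 * T.
  rewrite ler_wpM2r //; first by lra.
  have c4 : 1 <= c ^+ 2 by rewrite -[leLHS](expr1n _ 2) lerXn2r ?nnegrE //; lra.
  have -> : (32 * c) ^+ 4 = (1024 * c ^+ 2) ^+ 2 by ring.
  move: (c ^+ 2) c4 => q q1; apply: (@le_trans _ _ ((3 * q) ^+ 2)).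
    have : q <= q ^+ 2 by rewrite expr2; apply: ler_peMl; lra.
    lra.
  by apply: lerXn2r; rewrite ?nnegrE; lra.
lra.
Qed.

Lemma small_dense_set (R : realType) (sigma d : R) (G : sgraph) (m a : nat)
    (E := expR (2 / sigma ^+ 2) * (32 * (m + a)%:R) `^ (5 + sigma^-1)) :
  0 < sigma -> 1 < d -> (0 < m)%N -> sigma * m%:R + 1 <= a%:R <= sigma * m%:R + 2 ->
  ln d <= m%:R -> E <= d -> E <= d `^ sigma^-1 -> d <= avg_degree R G ->
  1 <= #|G|%:R * d `^ (- (1 + sigma^-1)) ->
  exists A : {set G}, [/\ A != set0,
    #|A|%:R <= #|G|%:R * d `^ (- (1 + sigma^-1)) * E &
    2 * (sigma + 1) * #|A|%:R <= (darts A)%:R].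
Proof.
move=> sigma0 d1 m0 ma dm Ed Eds hd hn.
set c := (m + a)%N in E Ed Eds *; set y : R := 32 * c%:R in E Ed Eds *.
have c2 : (1 < c)%N.
  case/andP: ma => ma1 _; rewrite /c -(ltr_nat R) natrD.
  have : 1 <= m%:R :> R by rewrite ler1n.
  have : 0 < sigma * m%:R by rewrite mulr_gt0 // ltr0n.
  lra.
have y0 : 0 < y by rewrite mulr_gt0 // ltr0n; lia.
have EE : E = expR (2 / sigma ^+ 2) * y `^ (1 + sigma^-1) * y ^+ 4.
  rewrite /E -mulrA -(powR_mulrn 4 (ltW y0)) -powRD; last first.
    by rewrite implybE [y == _]gt_eqF ?orbT.
  by congr (_ * _ `^ _); ring.
clearbody E; subst E.
have [z1 yd BD pt pd] := scale_parameters sigma0 d1 m0 ma dm Ed Eds.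
rewrite -/c in BD pt pd yd z1; rewrite -/y in BD pt pd yd z1.
set z := expR _ * _ in z1 pt Ed Eds *.
set B : R := (c * a.+1)%:R in BD pt pd *.
set p := B * _ in pt pd *.
set t := d `^ (- (1 + sigma^-1)) in hn pt *.
have B1 : 1 <= B by rewrite ler1n muln_gt0 ltnW.
have p0 : 0 <= p by rewrite mulr_ge0 ?powR_ge0 // (le_trans _ B1).
clear Ed Eds dm; clearbody z t.
have hG : 0 < #|G|%:R :> R.
  rewrite lt0r ler0n andbT; apply/eqP => G0.
  by move: hn; rewrite G0 mul0r ler10.
have d40 : 0 <= d / 4 by clear -d1; lra.
have /andP[] := truncn_itv d40; set dt := Num.trunc (d / 4).
rewrite -[dt.+1]addn1 natrD => dt1 dt2.
have [V0 V0n hV0] : exists2 V0 : {set G}, V0 != set0 &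
    {in V0, forall x, (dt <= #|nbh x :&: V0|)%N}.
  apply: large_min_degree; rewrite -(ltr_nat R).
  move: hd; rewrite avg_degreeE ler_pdivlMr //; apply: lt_le_trans.
  rewrite natrM ltr_pM2r // natrM; clear -dt1 d1; lra.
have V0p : 0 < #|V0|%:R :> R by rewrite ltr0n card_gt0.
have V0G : #|V0|%:R <= #|G|%:R :> R by rewrite ler_nat max_card.
have mc : m%:R <= c%:R :> R by rewrite ler_nat leq_addr.
have c2R : 2 <= c%:R :> R by rewrite ler_nat.
have hcm : (c + m)%:R <= dt%:R - d / 8 :> R.
  by rewrite natrD; move: yd; rewrite /y; clear -dt2 mc c2R; lra.
(* The bound [d / 8 <= delta] explains the 32 in [y]: with [y = 32 * c], the product
   [4 * c * (d / y)] is exactly [d / 8]. *)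
have [delta [dE delta8 delta_le]] : exists delta : nat,
    [/\ (delta + (c + m) = dt)%N, d / 8 <= delta%:R & delta%:R <= d / 4].
  have hle : (c + m <= dt)%N by rewrite -(ler_nat R); clear -hcm d1; lra.
  exists (dt - (c + m))%N; rewrite subnK // natrB //; split=> //.
    by clear -hcm; lra.
  by have := ler0n R (c + m)%N; clear -dt1; lra.
have hdeg : {in V0, forall x, (delta + c + m <= #|nbh x :&: V0|)%N}.
  by move=> x /hV0; rewrite -addnA dE.
clear hV0 dt1 dt2 dE hcm dt.
have D0 : 0 < d / y by rewrite divr_gt0 // (lt_trans _ d1).
have h4D : (4 * c)%:R * (d / y) <= delta%:R.
  rewrite (_ : _ * _ = d / 8) // natrM /y; field.
  by rewrite pnatr_eq0 -lt0n ltnW.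
have /andP[] := truncn_itv (mulr_ge0 (ltW V0p) p0).
(* Rounding up keeps [u / #|V0|] at least [p]. *)
set u := (Num.trunc (#|V0|%:R * p)).+1 => u1 u2.
have {}u1 : u%:R <= #|V0|%:R * p + 1 by rewrite /u -addn1 natrD lerD2r.
have hu : (u * delta <= #|V0|)%N.
  (* If [u = 1], the minimum degree gives [delta <= #|V0|]; otherwise rounding at most doubles, and
     [p * d <= 1] suffices. *)
  have [Vp|Vp] := ltP (#|V0|%:R * p) 1.
    have -> : u = 1%N.
      apply/eqP; rewrite eqn_leq /= andbT -ltnS -(ltr_nat R).
      by clear -u1 Vp; lra.
    rewrite mul1n; have [x xV0] := set0Pn _ V0n.
    apply: leq_trans (leq_trans (hdeg x xV0) _).
      by rewrite -addnA leq_addr.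
    by rewrite subset_leq_card // subsetIr.
  rewrite -(ler_nat R) natrM.
  have u2V : u%:R <= 2 * (#|V0|%:R * p) by clear -u1 Vp; lra.
  apply: (@le_trans _ _ (2 * (#|V0|%:R * p) * (d / 4))); first by apply: ler_pM.
  have : #|V0|%:R * (p * d) <= #|V0|%:R * 1 by rewrite ler_wpM2l // ltW.
  by clear -V0p; lra.
have [k l km l0 hl|A [An hA dA]] := dense_set_exists m0 (ltn0Sn _ : (0 < u)%N) D0 V0n hdeg hu h4D.
  case: l l0 hl => // l _ hl.
  have a0 : (0 < a)%N.
    rewrite -(ltr0n R); case/andP: ma => ma1 _; apply: lt_le_trans ma1.
    by rewrite addr_gt0 // mulr_gt0 // ltr0n.
  have hq : p <= u%:R / #|V0|%:R by rewrite ler_pdivlMr // mulrC ltW.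
  have hlm : (l * m <= k.+1 * a)%N by move: hl; rewrite mulSn leq_add2l.
  have := scale_power_bound a0 B1 BD hq hlm.
  rewrite -/c natrM -/B => /(ler_wpM2r (ler0n R u)) hB; apply: le_trans hB _.
  have -> : u%:R * (d / y) / #|V0|%:R = d / y * (u%:R / #|V0|%:R) by ring.
  rewrite [(d / y * _) ^+ _]exprMn exprD [(u%:R / _) ^+ l.+1]exprSr.
  move: (u%:R) ((d / y) ^+ k) ((d / y) ^+ l.+1) ((u%:R / #|V0|%:R) ^+ l) => x4 x1 x2 x3.
  rewrite le_eqVlt; apply/orP; left; apply/eqP; field.
  by rewrite lt0r_neq0.
exists A; split=> //.
  have uG : u%:R <= #|G|%:R * p + 1.
    by apply: le_trans u1 _; rewrite lerD2r ler_wpM2r.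
  have Bc : B <= c%:R ^+ 2.
    by rewrite /B natrM expr2 ler_wpM2l ?ler0n // ler_nat /c -add1n leq_add2r.
  have B0 : 0 <= B by exact: le_trans B1.
  apply: le_trans (size_bound c2R mc B0 Bc z1 (ltW hG) hn pt uG).
  by rewrite /B -!natrM natr1 -!natrD ler_nat.
have m0R : 0 < m%:R :> R by rewrite ltr0n.
rewrite -(ler_pM2l m0R) -natrM.
apply: (@le_trans _ _ (2 * c.-1 * #|A|)%:R); last by rewrite ler_nat.
rewrite !natrM !mulrA ler_wpM2r //.
have -> : c.-1%:R = c%:R - 1 :> R by rewrite -subn1 natrB // ltnW.
by case/andP: ma => ma1 _; rewrite /c natrD; clear -ma1; lra.
Qed.

Theorem theorem1p2 (R : realType) (s : R) (hs : 2 < s) :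
  exists C : R, exists d0 : R, forall d : R, d0 <= d ->
  forall (G : sgraph) (n : nat), #|G| = n ->
    d <= avg_degree R G ->
    d <= n%:R `^ ((s - 2) / s) ->
    exists A : {set G},
      [/\ A != set0,
          #|A|%:R <= n%:R * d `^ (- (s / (s - 2))) * (ln d) `^ C
        & s <= avg_degree R (induced_subgraph A)].
Proof.
(* Then [s = 2 * (sigma + 1)] and [s / (s - 2) = 1 + sigma^-1]. *)
pose sigma := s / 2 - 1.
have sigma0 : 0 < sigma by rewrite /sigma; lra.
have s2 : s - 2 != 0 by rewrite subr_eq0 gt_eqF.
have s_neq0 : s != 0 by rewrite gt_eqF // (lt_trans _ hs).
have kE : s / (s - 2) = 1 + sigma^-1 by rewrite /sigma; field.
have e0 : 0 <= 2 / sigma ^+ 2 by rewrite divr_ge0 // exprn_ge0 // ltW.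
have [C [d0 hC]] := parameters_exist sigma0 e0.
exists C, d0 => d /hC[d1 [m [a /= [m0 ma dm [EC Ed Eds]]]]] G n nE hd hdn.
subst n; have d00 : 0 < d by lra.
(* The upper bound on [d] enters here, in the form that the main term of the size bound is at least
   1. *)
have hn : 1 <= #|G|%:R * d `^ (- (1 + sigma^-1)).
  rewrite powRN ler_pdivlMr ?powR_gt0 // mul1r.
  have k0 : 0 <= 1 + sigma^-1 by rewrite addr_ge0 // invr_ge0 ltW.
  have := ge0_ler_powR k0 _ _ hdn; rewrite !nnegrE powR_ge0 ltW // => /(_ isT isT).
  rewrite -kE -powRrM (_ : _ / s * _ = 1) ?powRr1 //.
  by field; rewrite s_neq0 s2.
have [A [An hA dA]] := small_dense_set sigma0 d1 m0 ma dm Ed Eds hd hn.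
exists A; split=> //.
  rewrite kE; apply: le_trans hA _; rewrite ler_wpM2l ?mulr_ge0 ?powR_ge0 //.
rewrite avg_degree_induced ler_pdivlMr ?ltr0n ?card_gt0 //.
by apply: le_trans dA; rewrite /sigma (_ : 2 * _ = s) //; field.
Qed.
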